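(* Let $D\ge 1$ and fix $i\in\{1,\dots,D\}$. Let $\mathbf{r}_{ij}$ ($j=1,\dots,D$) be the residuals of the fitted projections for target series $i$, let $J_{ii}$ be the Jacobian of the fitted autoregressive projection $\hat f_{ii}(\mathbf{x}_i)$ with respect to its parameters $\theta_{ii}$, and put $\mathbf{r}_{-ii}:=\sum_{j\neq i}\mathbf{r}_{ij}$ and $\mathbf{r}_i:=\sum_{j=1}^D\mathbf{r}_{ij}=\mathbf{r}_{ii}+\mathbf{r}_{-ii}$. Assume that the random vectors $J_{ii}^\top\mathbf{r}_{ii}$ and $J_{ii}^\top\mathbf{r}_{-ii}$ have finite second moments, and let $$\Sigma_{ii}:=\mathrm{Cov}(-J_{ii}^\top\mathbf{r}_{ii}),\qquad \Sigma_{-ii}:=\mathrm{Cov}(-J_{ii}^\top\mathbf{r}_{-ii}).$$ If $$\|\Sigma_{-ii}\|_1 > 4\,\|\Sigma_{ii}\|_1,$$ where $\|\cdot\|_1$ denotes the trace norm, then $$\|\mathrm{Cov}(J_{ii}^\top\mathbf{r}_i)\|_1 > \|\Sigma_{ii}\|_1 .$$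
   Context: Setting: there are $D$ random input sequences $\mathbf{x}_1,\dots,\mathbf{x}_D\in\mathbb{R}^L$. For each $j$, $f_{ij}:\mathbb{R}^L\to\mathbb{R}^H$ is the true (deterministic) contribution of series $j$ to the target series $i$, and $\hat f_{ij}:\mathbb{R}^L\to\mathbb{R}^H$ is a fitted approximation with parameters $\theta_{ij}$. The residual of the fitted projection is $\mathbf{r}_{ij}:=f_{ij}(\mathbf{x}_j)-\hat f_{ij}(\mathbf{x}_j)\in\mathbb{R}^H$. $J_{ii}$ is the Jacobian matrix of $\hat f_{ii}(\mathbf{x}_i)$ with respect to $\theta_{ii}$ (it may depend on $\mathbf{x}_i$, hence be random). The ''true'' gradient for $\theta_{ii}$, i.e. that of $\frac12\sum_{i,j}\|\mathbf{r}_{ij}\|_2^2$, is $-J_{ii}^\top\mathbf{r}_{ii}$. The ''mixed'' gradient, i.e. that of $\frac12\sum_i\|\mathbf{r}_i\|_2^2$ with the aggregate residual $\mathbf{r}_i=\sum_{j=1}^D\mathbf{r}_{ij}$, is $-J_{ii}^\top\mathbf{r}_i$. Covariance matrices are taken over the randomness of the inputs. The trace norm of a matrix is the sum of its singular values (equal to the trace for a positive semidefinite matrix). *)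

(* Defs.v *)
From HB Require Import structures.
From mathcomp Require Import all_boot all_order all_algebra.
From mathcomp Require Import polyrcf.
From mathcomp Require Import all_classical all_reals all_analysis.

Set Implicit Arguments.
Unset Strict Implicit.
Unset Printing Implicit Defensive.

Import Order.TTheory GRing.Theory Num.Theory.
Import numFieldNormedType.Exports.

Local Open Scope classical_set_scope.
Local Open Scope ring_scope.

(* The real eigenvalues of M, repeated according to algebraic multiplicity.
   When M is symmetric, these are all the complex roots of char_poly M. *)
Definition eigenvalues_seq (R : realType) (n : nat) (M : 'M[R]_n) : seq R :=
  flatten [seq nseq (mup a (char_poly M)) a | a <- rootsR (char_poly M)].

(* There are n singular values of A : 'M_(m, n) in this list; if m < n, at
   least n - m of them are zero. *)
Definition singular_values (R : realType) (m n : nat) (A : 'M[R]_(m, n)) :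
    seq R :=
  [seq Num.sqrt a | a <- eigenvalues_seq (A^T *m A)].

Definition trace_norm (R : realType) (m n : nat) (A : 'M[R]_(m, n)) : R :=
  \sum_(s <- singular_values A) s.

Section RandomVectors.
Context (d : measure_display) (T : measurableType d) (R : realType).

(* The Borel sigma-algebra of R^n is the product one, so that measurability is
   a coordinatewise condition. *)
Definition random_rV (n : nat) (X : T -> 'rV[R]_n) : Prop :=
  forall k : 'I_n, measurable_fun [set: T] (fun w => X w ord0 k).

(* Membership in Lfun includes measurability. *)
Definition finite_second_moment (P : probability T R) (n : nat)
    (Y : T -> 'cV[R]_n) : Prop :=
  forall a : 'I_n, (fun w => Y w a ord0) \in Lfun P 2%:E.

(* The library covariance takes values in \bar R; it is finite for vectors with
   finite second moments. *)
Definition cov_mx (P : probability T R) (n : nat) (Y : T -> 'cV[R]_n) :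
    'M[R]_n :=
  \matrix_(a < n, b < n)
    fine (covariance P (fun w => Y w a ord0) (fun w => Y w b ord0)).

End RandomVectors.

Section Projections.
Context (R : realType) (T : Type) (D L H : nat).
Variable x : 'I_D -> T -> 'rV[R]_L.
Variable f : 'I_D -> 'I_D -> 'rV[R]_L -> 'rV[R]_H.
Variable p : 'I_D -> 'I_D -> nat.
Variable fhat : forall i j : 'I_D, 'rV[R]_(p i j) -> 'rV[R]_L -> 'rV[R]_H.
Variable theta : forall i j : 'I_D, 'rV[R]_(p i j).

Definition residual (i j : 'I_D) (w : T) : 'cV[R]_H :=
  (f i j (x j w) - fhat (theta i j) (x j w))^T.

(* The library jacobian acts on row vectors by right multiplication, hence the
   transposition: the entry (h, k) of J_ii is the partial derivative of the
   h-th output with respect to the k-th parameter. *)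
Definition J_ii (i : 'I_D) (w : T) : 'M[R]_(H, p i i) :=
  (jacobian (fun t : 'rV[R]_(p i i) => fhat t (x i w)) (theta i i))^T.

End Projections.

(* Main.v *)
(* A covariance matrix is positive semidefinite, so its trace norm is its trace,
   i.e. the sum of the variances of the coordinates. Since v = (u + v) - u,
   Var v <= 2 Var (u + v) + 2 Var u, and summing over the coordinates gives
   tr Cov v <= 2 tr Cov (u + v) + 2 tr Cov u. If tr Cov v > 4 tr Cov u, then
   tr Cov (u + v) > tr Cov u. *)
Require Import Defs.
From HB Require Import structures.
From mathcomp Require Import all_boot all_order all_algebra.
From mathcomp Require Import spectral polyrcf complex.
From mathcomp Require Import all_classical all_reals all_analysis.
From mathcomp Require Import lra.

Set Implicit Arguments.
Unset Strict Implicit.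
Unset Printing Implicit Defensive.

Import Order.TTheory GRing.Theory Num.Theory.
Import numFieldNormedType.Exports.

Local Open Scope classical_set_scope.
Local Open Scope ring_scope.

Lemma char_poly_similar (K : fieldType) (n : nat) (Q A : 'M[K]_n) :
  Q \in unitmx -> char_poly (invmx Q *m A *m Q) = char_poly A.
Proof.
move=> Qu.
have Qpu : map_mx polyC Q \in unitmx.
  by rewrite unitmxE det_map_mx rmorph_unit -?unitmxE.
rewrite /char_poly /char_poly_mx !map_mxM /= map_invmx.
set V := map_mx polyC Q in Qpu *.
(* Conjugation by [V] fixes the scalar matrix ['X%:M], so it carries one characteristic matrix to
   the other. *)
have -> : 'X%:M - invmx V *m map_mx polyC A *m V
    = invmx V *m ('X%:M - map_mx polyC A) *m V.
  rewrite mulmxBr mulmxBl; congr (_ - _).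
  by rewrite scalar_mxC -mulmxA mulVmx // mulmx1.
by rewrite !det_mulmx mulrC mulrA -det_mulmx mulmxV // det1 mul1r.
Qed.

(** Over [R[i]] the matrix is Hermitian, hence unitarily diagonalisable with real eigenvalues; the
    three identities are then pulled back along the injection [toC]. Having one family [s] for [M],
    [M *m M] and the trace is what links singular values to eigenvalues. *)
Lemma char_poly_symmetric (R : realType) (n : nat) (M : 'M[R]_n) :
  M^T = M ->
  exists s : 'I_n -> R,
    [/\ char_poly M = \prod_(k < n) ('X - (s k)%:P),
        char_poly (M *m M) = \prod_(k < n) ('X - (s k ^+ 2)%:P) &
        \tr M = \sum_(k < n) s k].
Proof.
move=> Msym; pose toC := real_complex R.
pose MC := map_mx toC M.
have MCherm : MC \is hermsymmx.
  apply: realsym_hermsym.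
    apply/is_hermitianmxP.
    by rewrite expr0 scale1r map_mx_id // /MC map_trmx Msym.
  by apply/mxOverP => a b; rewrite mxE; apply/complex_realP; exists (M a b).
have MCE := orthomx_spectralP (hermitian_normalmx MCherm).
have /mxOverP Dreal := hermitian_spectral_diag_real MCherm.
set Q := spectralmx MC in MCE; set D := spectral_diag MC in MCE Dreal.
have Qu : Q \in unitmx by exact: spectral_unit.
pose s k := complex.Re (D 0 k).
have DE k : D 0 k = toC (s k).
  by have /complex_realP[r rE] := Dreal 0 k; rewrite /s rE.
have toCI : injective (map_poly toC) by apply: map_inj_poly => //; exact: complexI.
have char_diag (v : 'rV[R[i]]_n) (c : 'I_n -> R) :
    (forall k, v 0 k = toC (c k)) ->
    char_poly (diag_mx v) = map_poly toC (\prod_(k < n) ('X - (c k)%:P)).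
  move=> vE; rewrite char_poly_trig ?diag_mx_is_trig // rmorph_prod.
  apply: eq_bigr => k _.
  by rewrite mxE eqxx mulr1n vE rmorphB /= map_polyX map_polyC.
exists s; split.
- apply: toCI; rewrite map_char_poly -/MC MCE char_poly_similar //.
  exact: char_diag.
- apply: toCI; rewrite map_char_poly map_mxM -/MC.
  have -> : MC *m MC = invmx Q *m (diag_mx D *m diag_mx D) *m Q.
    by rewrite [in LHS]MCE -!mulmxA (mulmxA Q) mulmxV // mul1mx.
  rewrite char_poly_similar // mulmx_diag; apply: char_diag => k.
  by rewrite mxE DE -rmorphM expr2.
apply: (@complexI R); rewrite [RHS](raddf_sum toC) -[LHS]trace_map_mx -/MC MCE.
rewrite mxtrace_mulC mulmxA mulmxV // mul1mx mxtrace_diag.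
by apply: eq_bigr => k _; rewrite DE.
Qed.

(** The roots are the distinct elements of [s], and the multiplicity of each is its number of
    occurrences in [s]. Equality up to order suffices, since the lists are only summed. *)
Lemma eigenvalues_seq_perm (R : realType) (n : nat) (M : 'M[R]_n) (s : seq R) :
  char_poly M = \prod_(a <- s) ('X - a%:P) -> perm_eq (eigenvalues_seq M) s.
Proof.
move=> ME; rewrite /eigenvalues_seq.
under eq_map => a do rewrite ME mu_prod_XsubC.
apply: perm_trans (perm_count_undup s); apply/perm_flatten/perm_map.
apply: uniq_perm; [exact: uniq_roots | exact: undup_uniq | move=> a].
have := @roots_on_rootsR _ (char_poly M) (monic_neq0 (char_poly_monic M)) a.
by rewrite mem_undup => <-; rewrite inE /= ME root_prod_XsubC.
Qed.

(** Since [M^T *m M = M *m M], the singular values are the square roots of the [s k ^+ 2], that is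
    the [s k] themselves once these are known to be nonnegative. *)
Lemma trace_norm_psd (R : realType) (n : nat) (M : 'M[R]_n) :
  M^T = M -> (forall v : 'rV[R]_n, 0 <= (v *m M *m v^T) 0 0) ->
  trace_norm M = \tr M.
Proof.
move=> Msym Mpsd; have [s [charM charMM ->]] := char_poly_symmetric Msym.
have s_ge0 k : 0 <= s k.
  have : root (char_poly M) (s k).
    by rewrite charM /root horner_prod (bigD1 k) //= hornerXsubC subrr mul0r.
  rewrite -eigenvalue_root_char => /eigenvalueP[v vM v_neq0].
  have := Mpsd v; rewrite vM -scalemxAl mxE pmulr_lge0 //.
  (* The form at an eigenvector [v] is [s k] times [v *m v^T]. It remains to see that this factor is
     positive: it is a sum of squares that vanishes only for [v = 0]. *)
  have vv k' : 0 <= v 0 k' * v^T k' 0 by rewrite !mxE -expr2 sqr_ge0.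
  rewrite lt0r mxE sumr_ge0 // andbT psumr_eq0 //.
  apply: contra v_neq0 => /allP v0; apply/eqP/rowP => j.
  by have := v0 j (mem_index_enum _); rewrite !mxE mulf_eq0 orbb => /eqP.
rewrite /trace_norm /singular_values Msym big_map.
rewrite (perm_big [seq s k ^+ 2 | k <- enum 'I_n]) /=; last first.
  by apply: eigenvalues_seq_perm; rewrite charMM big_map big_enum.
rewrite big_map big_enum /=.
by apply: eq_bigr => k _; rewrite sqrtr_sqr ger0_norm.
Qed.

Section CovarianceMatrix.
Context (d : measure_display) (T : measurableType d) (R : realType).
Variable P : probability T R.
Implicit Types X Y Z : T -> R.

Lemma Lfun2D X Y :
  X \in Lfun P 2%:E -> Y \in Lfun P 2%:E -> X \+ Y \in Lfun P 2%:E.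
Proof. by move=> X2 Y2; rewrite rpredD ?lee_fin ?ler1n. Qed.

(** Square integrability makes both covariances finite, so that [fine] commutes with the addition in
    [\bar R]. *)
Lemma fine_covarianceDl X Y Z :
  X \in Lfun P 2%:E -> Y \in Lfun P 2%:E -> Z \in Lfun P 2%:E ->
  fine (covariance P (X \+ Y) Z)
    = fine (covariance P X Z) + fine (covariance P Y Z).
Proof.
move=> X2 Y2 Z2; rewrite covarianceDl // fineD //.
- by rewrite covariance_fin_num ?Lfun2_mul_Lfun1 ?Lfun_subset12 ?fin_num_measure.
- by rewrite covariance_fin_num ?Lfun2_mul_Lfun1 ?Lfun_subset12 ?fin_num_measure.
Qed.

Lemma fine_covarianceZl (c : R) X Y :
  X \in Lfun P 2%:E -> Y \in Lfun P 2%:E ->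
  fine (covariance P (c \o* X) Y) = c * fine (covariance P X Y).
Proof.
move=> X2 Y2.
by rewrite covarianceZl ?fineM ?covariance_fin_num ?Lfun2_mul_Lfun1
  ?Lfun_subset12 ?fin_num_measure.
Qed.

Lemma Lfun2_lincomb (I : Type) (s : seq I) (c : I -> R) (X : I -> T -> R) :
  (forall k, X k \in Lfun P 2%:E) ->
  (fun w => \sum_(k <- s) c k * X k w) \in Lfun P 2%:E.
Proof.
move=> X2; elim: s => [|k s IHs].
  rewrite (_ : (fun w => _) = cst 0) ?Lfun_cst //.
  by apply/funext => w; rewrite big_nil.
rewrite (_ : (fun w => _) =
    (c k \o* X k) \+ (fun w => \sum_(k <- s) c k * X k w)).
  by rewrite Lfun2D ?Lfun_scale ?ler1n.
by apply/funext => w; rewrite big_cons /= [X in _ = X + _]mulrC.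
Qed.

Lemma fine_covariance_lincombl (I : Type) (s : seq I) (c : I -> R)
    (X : I -> T -> R) Z :
  (forall k, X k \in Lfun P 2%:E) -> Z \in Lfun P 2%:E ->
  fine (covariance P (fun w => \sum_(k <- s) c k * X k w) Z)
    = \sum_(k <- s) c k * fine (covariance P (X k) Z).
Proof.
move=> X2 Z2; elim: s => [|k s IHs].
  rewrite (_ : (fun w => _) = cst 0) ?covariance_cst_l ?big_nil //.
  by apply/funext => w; rewrite big_nil.
rewrite (_ : (fun w => _) =
    (c k \o* X k) \+ (fun w => \sum_(k <- s) c k * X k w)); last first.
  by apply/funext => w; rewrite big_cons /= [X in _ = X + _]mulrC.
rewrite fine_covarianceDl ?Lfun_scale ?ler1n ?Lfun2_lincomb //.
by rewrite fine_covarianceZl // IHs big_cons.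
Qed.

Lemma trmx_cov_mx (n : nat) (Y : T -> 'cV[R]_n) : (cov_mx P Y)^T = cov_mx P Y.
Proof. by apply/matrixP => a b; rewrite !mxE covarianceC. Qed.

(** The quadratic form at [v] is the variance of the linear combination [Z] of the coordinates of
    [Y] with coefficients [v]. *)
Lemma cov_mx_psd (n : nat) (Y : T -> 'cV[R]_n) (v : 'rV[R]_n) :
  finite_second_moment P Y -> 0 <= (v *m cov_mx P Y *m v^T) 0 0.
Proof.
move=> Y2; pose Z := fun w => \sum_(a < n) v 0 a * Y w a 0.
have Z2 : Z \in Lfun P 2%:E by apply: Lfun2_lincomb => a; exact: Y2.
suff -> : (v *m cov_mx P Y *m v^T) 0 0 = fine 'V_P[Z].
  by rewrite fine_ge0 ?variance_ge0.
rewrite -mulmxA mxE /variance.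
rewrite (fine_covariance_lincombl _ _ Y2 Z2).
(* Symmetry of the covariance lets linearity on the left expand the second argument as well. *)
apply: eq_bigr => a _; rewrite mxE covarianceC.
rewrite (fine_covariance_lincombl _ _ Y2 (Y2 a)).
congr (_ * _); apply: eq_bigr => b _.
by rewrite !mxE mulrC covarianceC.
Qed.

(** This reduces trace norms of covariance matrices to scalar variances, which can be compared
    coordinate by coordinate. *)
Lemma trace_norm_cov_mx (n : nat) (Y : T -> 'cV[R]_n) :
  finite_second_moment P Y ->
  trace_norm (cov_mx P Y) = \sum_(a < n) fine 'V_P[fun w => Y w a 0].
Proof.
move=> Y2; rewrite trace_norm_psd; first by apply: eq_bigr => a _; rewrite mxE.
  exact: trmx_cov_mx.
by move=> v; exact: cov_mx_psd.
Qed.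

(** The signs cancel by bilinearity; this removes the minus signs of the gradients from [Sigma_ii]
    and [Sigma_mii]. *)
Lemma cov_mxN (n : nat) (Y : T -> 'cV[R]_n) :
  finite_second_moment P Y -> cov_mx P (fun w => - Y w) = cov_mx P Y.
Proof.
move=> Y2; apply/matrixP => a b; rewrite !mxE.
rewrite -(covarianceNN (X := fun w => Y w a 0) (Y := fun w => Y w b 0))
  ?Lfun2_mul_Lfun1 ?Lfun_subset12 ?fin_num_measure //.
by congr (fine (covariance P _ _)); apply/funext => w; rewrite mxE.
Qed.

Lemma finite_second_momentD (n : nat) (Y Z : T -> 'cV[R]_n) :
  finite_second_moment P Y -> finite_second_moment P Z ->
  finite_second_moment P (fun w => Y w + Z w).
Proof.
move=> Y2 Z2 a.
rewrite (_ : (fun w => _) = (fun w => Y w a 0) \+ (fun w => Z w a 0)) ?Lfun2D //.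
by apply/funext => w; rewrite mxE.
Qed.

(* From the parallelogram law for X + Y and X, dropping Var (2 X + Y). *)
Lemma variance_le_add X Y : X \in Lfun P 2%:E -> Y \in Lfun P 2%:E ->
  fine 'V_P[Y] <= 2 * fine 'V_P[X \+ Y] + 2 * fine 'V_P[X].
Proof.
move=> X2 Y2; have S2 : X \+ Y \in Lfun P 2%:E by rewrite Lfun2D.
have YE : Y = (X \+ Y) \- X by apply/funext => w /=; rewrite addrC addKr.
have cov_fin : covariance P (X \+ Y) X \is a fin_num.
  by rewrite covariance_fin_num ?Lfun2_mul_Lfun1 ?Lfun_subset12 ?fin_num_measure.
have : 0 <= fine 'V_P[(X \+ Y) \+ X] by rewrite fine_ge0 ?variance_ge0.
rewrite varianceD // [in fine 'V_P[Y]]YE varianceB //.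
have VX := variance_fin_num X2; have VS := variance_fin_num S2.
(* Finiteness turns the expansions into real identities. The covariance of [X \+ Y] and [X] enters
   them with opposite signs, so that it cancels. *)
rewrite fineB ?fineD ?fin_numD ?fin_numM ?VX ?VS //= ?fineM //=.
lra.
Qed.

Lemma trace_norm_cov_mx_le_add (n : nat) (Y Z : T -> 'cV[R]_n) :
  finite_second_moment P Y -> finite_second_moment P Z ->
  trace_norm (cov_mx P Z) <=
    2 * trace_norm (cov_mx P (fun w => Y w + Z w))
    + 2 * trace_norm (cov_mx P Y).
Proof.
move=> Y2 Z2; rewrite !trace_norm_cov_mx //; last exact: finite_second_momentD.
rewrite !mulr_sumr -big_split /=; apply: ler_sum => a _.
rewrite (_ : (fun w => (Y w + Z w) a 0) =
  (fun w => Y w a 0) \+ (fun w => Z w a 0)) ?variance_le_add //.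
by apply/funext => w; rewrite mxE.
Qed.

End CovarianceMatrix.

Theorem mainTheorem2 (R : realType) (d : measure_display)
    (T : measurableType d) (P : probability T R) (D L H : nat)
    (x : 'I_D -> T -> 'rV[R]_L)
    (f : 'I_D -> 'I_D -> 'rV[R]_L -> 'rV[R]_H)
    (p : 'I_D -> 'I_D -> nat)
    (fhat : forall i j : 'I_D, 'rV[R]_(p i j) -> 'rV[R]_L -> 'rV[R]_H)
    (theta : forall i j : 'I_D, 'rV[R]_(p i j))
    (i : 'I_D)
    (hx : forall j : 'I_D, random_rV (x j))
    (hdiff : {ae P, forall w : T,
       differentiable (fun t : 'rV[R]_(p i i) => fhat i i t (x i w))
         (theta i i)}) :
  let r := residual x f fhat theta i in
  let J := J_ii x fhat theta i in
  let r_mii := fun w : T => \sum_(j < D | j != i) r j w in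
  let r_i := fun w : T => \sum_(j < D) r j w in
  let Sigma_ii := cov_mx P (fun w : T => - ((J w)^T *m r i w)) in
  let Sigma_mii := cov_mx P (fun w : T => - ((J w)^T *m r_mii w)) in
  finite_second_moment P (fun w : T => (J w)^T *m r i w) ->
  finite_second_moment P (fun w : T => (J w)^T *m r_mii w) ->
  4 * trace_norm Sigma_ii < trace_norm Sigma_mii ->
  trace_norm Sigma_ii < trace_norm (cov_mx P (fun w : T => (J w)^T *m r_i w)).
Proof.
move=> r J r_mii r_i Sigma_ii Sigma_mii U2 V2.
rewrite /Sigma_ii /Sigma_mii !cov_mxN //.
(* The two summands are the vectors with finite second moments given by [U2] and [V2]. *)
have -> : (fun w => (J w)^T *m r_i w)
    = (fun w => (J w)^T *m r i w + (J w)^T *m r_mii w).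
  by apply/funext => w; rewrite -mulmxDr /r_i (bigD1 i).
(* With [s], [m], [t] the trace norms for [r i], [r_mii] and [r_i], the chain
   [4 * s < m <= 2 * t + 2 * s] gives [s < t]. *)
by have := trace_norm_cov_mx_le_add U2 V2; lra.
Qed.
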